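(* Let $(\mathcal C,c)$ be a left rigid braided (strict) monoidal category. Let $\mathcal R(\mathcal C,c)$ be the category whose objects are pairs $(V,\eta_V)$ consisting of an object $V$ of $\mathcal C$ and an automorphism $\eta_V$ of $V$ in $\mathcal C$ satisfying $$\eta_V^{-2}=(\mathrm{Id}_V\otimes\mathrm{ev}_V)(c_{V^*,V}c_{V,V^*}\mathrm{coev}_V\otimes\mathrm{Id}_V)=(\mathrm{ev}_V\otimes\mathrm{Id}_V)(\mathrm{Id}_{V^*}\otimes c_{V,V}^{-1})(c_{V,V^*}\mathrm{coev}_V\otimes\mathrm{Id}_V),$$ and whose morphisms $(V,\eta_V)\to(W,\eta_W)$ are the morphisms $f:V\to W$ in $\mathcal C$ with $\eta_Wf=f\eta_V$ (composition and identities as in $\mathcal C$). Then $\mathcal R(\mathcal C,c)$ is a ribbon monoidal category as follows: $\bullet$ for $(V,\eta_V),(W,\eta_W)\in\mathcal R(\mathcal C,c)$, $(V,\eta_V)\otimes(W,\eta_W)=(V\otimes W,\eta_{V\otimes W})$ where $\eta_{V\otimes W}=(\eta_V\otimes\eta_W)c_{W,V}c_{V,W}$; $\bullet$ the unit object is $(\underline1,\eta_{\underline1}=\mathrm{Id}_{\underline1})$, and the associativity and the left and right unit constraints are those of $\mathcal C$; $\bullet$ the braiding equals $c$, regarded as an isomorphism in $\mathcal R(\mathcal C,c)$; $\bullet$ a left dual of $(V,\eta_V)$ is $(V^*,\eta_{V^*})$ with $\eta_{V^*}=(\eta_V)^*$, with evaluation and coevaluation morphisms $\mathrm{ev}_V$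 and $\mathrm{coev}_V$, viewed as morphisms in $\mathcal R(\mathcal C,c)$; $\bullet$ the twist is given by $\eta_V:(V,\eta_V)\to(V,\eta_V)$, an automorphism in $\mathcal R(\mathcal C,c)$.
   Context: A left rigid monoidal category is one in which every object $V$ has a left dual $V^*$ with evaluation $\mathrm{ev}_V:V^*\otimes V\to\underline1$ and coevaluation $\mathrm{coev}_V:\underline1\to V\otimes V^*$ satisfying the usual triangle identities; $f^*$ denotes the transpose of $f$. A braided category $(\mathcal C,c)$ is a monoidal category with a braiding $c=(c_{X,Y}:X\otimes Y\to Y\otimes X)$. Formulas are written as in the strict case, with associativity and unit constraints suppressed. A braided category $(\mathcal C,c)$ is balanced if it has a natural isomorphism (twist) $\eta=(\eta_V:V\to V)_V$ with $\eta_{V\otimes W}=(\eta_V\otimes\eta_W)c_{W,V}c_{V,W}$ for all $V,W$. A balanced category $(\mathcal C,c,\eta)$ is ribbon if moreover $\mathcal C$ is left rigid and $\eta_{V^*}=(\eta_V)^*$ for all $V$. *)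

(* Defs.v *)
From Corelib Require Import ssreflect ssrfun ssrbool.
From Stdlib Require Import ProofIrrelevance.

Set Implicit Arguments.
Unset Strict Implicit.
Unset Printing Implicit Defensive.

Declare Scope cat_scope.
Delimit Scope cat_scope with cat.
Local Open Scope cat_scope.

Record category := Category {
  obj :> Type;
  hom : obj -> obj -> Type;
  idm : forall A, hom A A;
  comp : forall A B C, hom B C -> hom A B -> hom A C;
  comp1m : forall A B (f : hom A B), comp (idm B) f = f;
  compm1 : forall A B (f : hom A B), comp f (idm A) = f;
  compA : forall A B C D (h : hom C D) (g : hom B C) (f : hom A B),
    comp h (comp g f) = comp (comp h g) f }.

Arguments hom {c} A B.
Arguments idm {c} A.
Arguments comp {c A B C} g f.

Notation "A ~> B" := (hom A B) (at level 70, no associativity) : cat_scope.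
Notation "g ∘ f" := (comp g f) (at level 40, left associativity) : cat_scope.

Record iso (C : category) (A B : C) := Iso {
  fwd : A ~> B;
  bwd : B ~> A;
  fwdK : bwd ∘ fwd = idm A;
  bwdK : fwd ∘ bwd = idm B }.

Arguments Iso {C A B} fwd bwd fwdK bwdK.
Arguments fwd {C A B} i.
Arguments bwd {C A B} i.

(* Strictness is not required of the constraints: equalities between objects
   are awkward to compute with, and a strict category is the case where all
   constraints are identities.  The object parts of the structures (tensor
   product, unit, duals) are parameters of the records, so that two structures
   on convertible objects can be compared morphism by morphism. *)
Record monoidal (C : category) (tens : C -> C -> C) (one : C) := Monoidal {
  tensm : forall A B A' B', A ~> A' -> B ~> B' -> tens A B ~> tens A' B';
  tensm1 : forall A B, tensm (idm A) (idm B) = idm (tens A B);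
  tensm_comp : forall A B A' B' A'' B''
      (f' : A' ~> A'') (f : A ~> A') (g' : B' ~> B'') (g : B ~> B'),
    tensm (f' ∘ f) (g' ∘ g) = tensm f' g' ∘ tensm f g;
  assoc : forall A B D, iso (tens (tens A B) D) (tens A (tens B D));
  lunit : forall A, iso (tens one A) A;
  runit : forall A, iso (tens A one) A;
  assoc_nat : forall A B D A' B' D'
      (f : A ~> A') (g : B ~> B') (h : D ~> D'),
    fwd (assoc A' B' D') ∘ tensm (tensm f g) h
    = tensm f (tensm g h) ∘ fwd (assoc A B D);
  lunit_nat : forall A A' (f : A ~> A'),
    fwd (lunit A') ∘ tensm (idm one) f = f ∘ fwd (lunit A);
  runit_nat : forall A A' (f : A ~> A'),
    fwd (runit A') ∘ tensm f (idm one) = f ∘ fwd (runit A);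
  pentagon : forall A B D E,
    fwd (assoc A B (tens D E)) ∘ fwd (assoc (tens A B) D E)
    = tensm (idm A) (fwd (assoc B D E)) ∘ fwd (assoc A (tens B D) E)
      ∘ tensm (fwd (assoc A B D)) (idm E);
  triangle : forall A B,
    tensm (idm A) (fwd (lunit B)) ∘ fwd (assoc A one B)
    = tensm (fwd (runit A)) (idm B) }.

Arguments tensm {C tens one} m {A B A' B'} f g.
Arguments assoc {C tens one} m A B D.
Arguments lunit {C tens one} m A.
Arguments runit {C tens one} m A.

Record braiding (C : category) (tens : C -> C -> C) (one : C)
    (M : monoidal tens one) := Braiding {
  braid :> forall A B, iso (tens A B) (tens B A);
  braid_nat : forall A B A' B' (f : A ~> A') (g : B ~> B'),
    fwd (braid A' B') ∘ tensm M f g = tensm M g f ∘ fwd (braid A B);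
  hexagon1 : forall A B D,
    fwd (assoc M B D A) ∘ fwd (braid A (tens B D)) ∘ fwd (assoc M A B D)
    = tensm M (idm B) (fwd (braid A D)) ∘ fwd (assoc M B A D)
      ∘ tensm M (fwd (braid A B)) (idm D);
  hexagon2 : forall A B D,
    bwd (assoc M D A B) ∘ fwd (braid (tens A B) D) ∘ bwd (assoc M A B D)
    = tensm M (fwd (braid A D)) (idm B) ∘ bwd (assoc M A D B)
      ∘ tensm M (idm A) (fwd (braid B D)) }.

Record left_rigid (C : category) (tens : C -> C -> C) (one : C)
    (M : monoidal tens one) (dual : C -> C) := LeftRigid {
  ev : forall V, tens (dual V) V ~> one;
  coev : forall V, one ~> tens V (dual V);
  zigzag1 : forall V,
    fwd (runit M V) ∘ tensm M (idm V) (ev V) ∘ fwd (assoc M V (dual V) V)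
      ∘ tensm M (coev V) (idm V) ∘ bwd (lunit M V)
    = idm V;
  zigzag2 : forall V,
    fwd (lunit M (dual V)) ∘ tensm M (ev V) (idm (dual V))
      ∘ bwd (assoc M (dual V) V (dual V))
      ∘ tensm M (idm (dual V)) (coev V) ∘ bwd (runit M (dual V))
    = idm (dual V) }.

Arguments ev {C tens one M dual} l V.
Arguments coev {C tens one M dual} l V.

Definition transpose (C : category) (tens : C -> C -> C) (one : C)
    (M : monoidal tens one) (dual : C -> C) (D : left_rigid M dual)
    (V W : C) (f : V ~> W) : dual W ~> dual V :=
  fwd (lunit M (dual V)) ∘ tensm M (ev D W) (idm (dual V))
    ∘ bwd (assoc M (dual W) W (dual V))
    ∘ tensm M (idm (dual W)) (tensm M f (idm (dual V)))
    ∘ tensm M (idm (dual W)) (coev D V) ∘ bwd (runit M (dual W)).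

Record balancing (C : category) (tens : C -> C -> C) (one : C)
    (M : monoidal tens one) (c : braiding M) := Balancing {
  twist :> forall V, iso V V;
  twist_nat : forall V W (f : V ~> W), fwd (twist W) ∘ f = f ∘ fwd (twist V);
  twist_tens : forall V W,
    fwd (twist (tens V W))
    = tensm M (fwd (twist V)) (fwd (twist W)) ∘ fwd (c W V) ∘ fwd (c V W) }.

Record ribbon (C : category) (tens : C -> C -> C) (one : C) (dual : C -> C) :=
  Ribbon {
  rib_monoidal : monoidal tens one;
  rib_braiding : braiding rib_monoidal;
  rib_rigid : left_rigid rib_monoidal dual;
  rib_twist : balancing rib_braiding;
  rib_twist_dual : forall V,
    fwd (rib_twist (dual V)) = transpose rib_rigid (fwd (rib_twist V)) }.

Section RibbonObjects.

Variables (C : category) (tens : C -> C -> C) (one : C).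
Variables (M : monoidal tens one) (c : braiding M).
Variables (dual : C -> C) (D : left_rigid M dual).

(* (Id_V ⊗ ev_V) (c_{V*,V} c_{V,V*} coev_V ⊗ Id_V) *)
Definition double_braid_loop (V : C) : V ~> V :=
  fwd (runit M V) ∘ tensm M (idm V) (ev D V) ∘ fwd (assoc M V (dual V) V)
    ∘ tensm M (fwd (c (dual V) V) ∘ fwd (c V (dual V)) ∘ coev D V) (idm V)
    ∘ bwd (lunit M V).

(* (ev_V ⊗ Id_V) (Id_{V*} ⊗ c_{V,V}^{-1}) (c_{V,V*} coev_V ⊗ Id_V) *)
Definition inverse_braid_loop (V : C) : V ~> V :=
  fwd (lunit M V) ∘ tensm M (ev D V) (idm V) ∘ bwd (assoc M (dual V) V V)
    ∘ tensm M (idm (dual V)) (bwd (c V V)) ∘ fwd (assoc M (dual V) V V)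
    ∘ tensm M (fwd (c V (dual V)) ∘ coev D V) (idm V)
    ∘ bwd (lunit M V).

Definition half_twist (V : C) (h : V ~> V) : Prop :=
  exists i : iso V V,
    [/\ fwd i = h,
        bwd i ∘ bwd i = double_braid_loop V &
        double_braid_loop V = inverse_braid_loop V].

Record rib_obj := RibObj {
  rib_carrier :> C;
  rib_eta : rib_carrier ~> rib_carrier;
  rib_etaP : half_twist rib_eta }.

Record rib_hom (X Y : rib_obj) := RibHom {
  rib_mor : rib_carrier X ~> rib_carrier Y;
  rib_morP : rib_eta Y ∘ rib_mor = rib_mor ∘ rib_eta X }.

Lemma rib_hom_eq (X Y : rib_obj) (f g : rib_hom X Y) :
  rib_mor f = rib_mor g -> f = g.
Proof.
case: f g => [f hf] [g hg] /= E; subst g.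
by congr RibHom; apply: proof_irrelevance.
Qed.

Lemma rib_id_subproof (X : rib_obj) :
  rib_eta X ∘ idm (rib_carrier X) = idm (rib_carrier X) ∘ rib_eta X.
Proof. by rewrite compm1 comp1m. Qed.

Lemma rib_comp_subproof (X Y Z : rib_obj) (g : rib_hom Y Z) (f : rib_hom X Y) :
  rib_eta Z ∘ (rib_mor g ∘ rib_mor f) = (rib_mor g ∘ rib_mor f) ∘ rib_eta X.
Proof. by rewrite compA (rib_morP g) -compA (rib_morP f) compA. Qed.

Definition rib_cat : category.
Proof.
refine (@Category rib_obj rib_hom
  (fun X => RibHom (rib_id_subproof X))
  (fun X Y Z g f => RibHom (rib_comp_subproof g f)) _ _ _).
- by move=> X Y f; apply: rib_hom_eq; apply: comp1m.
- by move=> X Y f; apply: rib_hom_eq; apply: compm1.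
- by move=> X Y Z T h g f; apply: rib_hom_eq; apply: compA.
Defined.

Definition tens_eta (X Y : rib_obj) :
    tens (rib_carrier X) (rib_carrier Y) ~> tens (rib_carrier X) (rib_carrier Y) :=
  tensm M (rib_eta X) (rib_eta Y)
    ∘ fwd (c (rib_carrier Y) (rib_carrier X))
    ∘ fwd (c (rib_carrier X) (rib_carrier Y)).

End RibbonObjects.

Arguments RibObj {C tens one M c dual D} rib_carrier rib_eta rib_etaP.
Arguments rib_carrier {C tens one M c dual D} r.
Arguments rib_eta {C tens one M c dual D} r.
Arguments rib_mor {C tens one M c dual D X Y} r.

(* Main.v *)
From Corelib Require Import ssreflect ssrfun ssrbool.
Require Import Defs.

(** Consider all pairs of an object and an automorphism of it, with the tensor
product of two pairs (A, h) and (B, k) given by the endomorphism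
[tens_twist h k], that is (h ⊗ k) c c.  Call a map of C between two such pairs
compatible when it intertwines the automorphisms.  With the given constraints
and braiding this is a balanced category, whatever the automorphisms:
naturality of the braiding makes tensor products of compatible maps
compatible, the braiding is compatible because it commutes with its own double,
the unit constraints because c_{A,1} and c_{1,A} are inverse to each other,
and the associator because the two ways to build the full twist on three
strands agree (Yang-Baxter, [monodromy_assoc]).  The whole content of the
theorem is therefore that the pairs singled out by the half twist condition
are closed under tensor products and duals, contain the unit, and have
compatible evaluations and coevaluations.

Write V^∨ for the dual of V, and h^∨ for the transpose of h.  The key remark
is that the condition on (V, h) says exactly that coev_V is a compatible map
1 -> (V, h) ⊗ (V^∨, h^∨).  First, the two loops in the condition are always
equal ([loops_eq]): naturality of c_{-, V} along ev_V expresses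
(1 ⊗ ev) (c_{V^∨, V} ⊗ 1) through c_{V, V}^{-1}.  Second, the loop a_V is the
endomorphism of V that does to coev_V what a double braid does:
(a_V ⊗ 1) coev_V = c c coev_V ([loop_coev]).  Thus h h a_V = 1 if and only if
(h ⊗ h^∨) c c coev_V = coev_V.  Moreover V^∨ may be replaced in this criterion
by any P with a map k : 1 -> U ⊗ P that separates endomorphisms of U, because
k factors through coev_U ([half_twistI]).  The three closure properties follow
by choosing k:
- for V ⊗ W, the two coevaluations nested in each other, with
  P = W^∨ ⊗ V^∨.  It is compatible because it is a composite of compatible
  maps; a double braid on V ⊗ W slides around the nested cups to one on
  W^∨ ⊗ V^∨ ([nest_monodromy]);
- for V^∨, the coevaluation of V followed by the braiding, with P = V;
- for 1, its own coevaluation.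

Compatibility of ev_V is deduced from that of coev_V: an evaluation is
determined by the coevaluation ([ev_unique]), and ev_V composed with the
automorphism of V^∨ ⊗ V still satisfies the triangle identity, since the
automorphism can be moved past the compatible map coev_V ⊗ 1.

The associativity constraints are dealt with by letting every map
f : A -> B act as f ⊗ 1_T, on objects bracketed to the right with an arbitrary
last factor T.  In that form braidings ([swap]), coevaluations ([cup]) and
evaluations ([cap]) obey the identities of a strict monoidal category, with no
associator left, and T = 1 recovers the original maps. *)

Set Implicit Arguments.
Unset Strict Implicit.
Unset Printing Implicit Defensive.

Local Open Scope cat_scope.

(** * Composition and isomorphisms *)
Section Category.
Variable C : category.

(** Composites are kept bracketed to the right; this turns an identity into one
that rewrites in front of a further map. *)
Lemma reassoc (A B B' : C) (g : B ~> B') (f : A ~> B) (h : A ~> B') :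
  g ∘ f = h -> forall T (x : T ~> A), g ∘ (f ∘ x) = h ∘ x.
Proof. by move=> <- T x; rewrite compA. Qed.

Lemma reassoc3 (A B B' B'' : C) (l : B' ~> B'') (g : B ~> B') (f : A ~> B)
    (h : A ~> B'') :
  l ∘ (g ∘ f) = h -> forall T (x : T ~> A), l ∘ (g ∘ (f ∘ x)) = h ∘ x.
Proof. by move=> <- T x; rewrite !compA. Qed.

Lemma bwd_fwd (A B : C) (i : iso A B) T (x : T ~> A) :
  bwd i ∘ (fwd i ∘ x) = x.
Proof. by rewrite (reassoc (fwdK i)) comp1m. Qed.

Lemma fwd_bwd (A B : C) (i : iso A B) T (x : T ~> B) :
  fwd i ∘ (bwd i ∘ x) = x.
Proof. by rewrite (reassoc (bwdK i)) comp1m. Qed.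

Lemma fwd_mono (A B : C) (i : iso A B) T (f g : T ~> A) :
  fwd i ∘ f = fwd i ∘ g -> f = g.
Proof. by move=> E; rewrite -(bwd_fwd i f) E bwd_fwd. Qed.

Lemma fwd_epi (A B : C) (i : iso A B) T (f g : B ~> T) :
  f ∘ fwd i = g ∘ fwd i -> f = g.
Proof. by move=> E; rewrite -(compm1 f) -(bwdK i) compA E -compA bwdK compm1. Qed.

Definition iso_inv (A B : C) (i : iso A B) : iso B A :=
  Iso (bwd i) (fwd i) (bwdK i) (fwdK i).

Lemma iso_comp_subproof (A B B' : C) (j : iso B B') (i : iso A B) :
  bwd i ∘ bwd j ∘ (fwd j ∘ fwd i) = idm A.
Proof. by rewrite -compA bwd_fwd fwdK. Qed.

Definition iso_comp (A B B' : C) (j : iso B B') (i : iso A B) : iso A B' :=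
  Iso (fwd j ∘ fwd i) (bwd i ∘ bwd j) (iso_comp_subproof j i)
    (iso_comp_subproof (iso_inv i) (iso_inv j)).

Definition intertwines (A B : C) (h : A ~> A) (k : B ~> B) (f : A ~> B) :=
  k ∘ f = f ∘ h.

Lemma intertwines_comp (A B B' : C) (h : A ~> A) (k : B ~> B) (l : B' ~> B')
    (g : B ~> B') (f : A ~> B) :
  intertwines k l g -> intertwines h k f -> intertwines h l (g ∘ f).
Proof. by rewrite /intertwines => E F; rewrite (reassoc E) -compA F compA. Qed.

Lemma intertwines_bwd (A B : C) (h : A ~> A) (k : B ~> B) (i : iso A B) :
  intertwines h k (fwd i) -> intertwines k h (bwd i).
Proof.
by rewrite /intertwines => E; apply: (fwd_mono (i := i));
  rewrite fwd_bwd compA -E -compA bwdK compm1.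
Qed.

End Category.

(** * Cups and caps with a right-bracketed tail *)
Section Monoidal.
Variables (C : category) (tens : C -> C -> C) (one : C).
Variable M : monoidal tens one.

Local Notation "A ⊗ B" := (tens A B) (at level 35, right associativity).
Local Notation "A ◁ g" := (tensm M (idm A) g) (at level 36, right associativity).
Local Notation "f ▷ T" := (tensm M f (idm T)) (at level 37, left associativity).
Local Notation α A B T := (fwd (assoc M A B T)).
Local Notation λ T := (fwd (lunit M T)).
Local Notation ρ T := (fwd (runit M T)).

Lemma whiskl_comp A B B' B'' (g : B' ~> B'') (f : B ~> B') :
  A ◁ (g ∘ f) = (A ◁ g) ∘ (A ◁ f).
Proof. by rewrite -tensm_comp comp1m. Qed.

Lemma whiskr_comp T B B' B'' (g : B' ~> B'') (f : B ~> B') :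
  (g ∘ f) ▷ T = (g ▷ T) ∘ (f ▷ T).
Proof. by rewrite -tensm_comp comp1m. Qed.

Lemma whisk_exchange A A' B B' (f : A ~> A') (g : B ~> B') :
  (f ▷ B') ∘ (A ◁ g) = (A' ◁ g) ∘ (f ▷ B).
Proof. by rewrite -!tensm_comp !comp1m !compm1. Qed.

Lemma tensm_whisk A A' B B' (f : A ~> A') (g : B ~> B') :
  tensm M f g = (f ▷ B') ∘ (A ◁ g).
Proof. by rewrite -tensm_comp comp1m compm1. Qed.

Lemma tens_iso_subproof A A' B B' (i : iso A A') (j : iso B B') :
  tensm M (bwd i) (bwd j) ∘ tensm M (fwd i) (fwd j) = idm (A ⊗ B).
Proof. by rewrite -tensm_comp !fwdK tensm1. Qed.

Definition tens_iso A A' B B' (i : iso A A') (j : iso B B') :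
    iso (A ⊗ B) (A' ⊗ B') :=
  Iso (tensm M (fwd i) (fwd j)) (tensm M (bwd i) (bwd j))
    (tens_iso_subproof i j) (tens_iso_subproof (iso_inv i) (iso_inv j)).

Definition id_iso (A : C) : iso A A :=
  Iso (idm A) (idm A) (comp1m (idm A)) (comp1m (idm A)).

Definition whiskl_iso A B B' (i : iso B B') : iso (A ⊗ B) (A ⊗ B') :=
  tens_iso (id_iso A) i.

Definition whiskr_iso T B B' (i : iso B B') : iso (B ⊗ T) (B' ⊗ T) :=
  tens_iso i (id_iso T).

Lemma whiskl_eq A B B' B'' (g : B' ~> B'') (f : B ~> B') h :
  g ∘ f = h ->
  forall T (x : T ~> A ⊗ B), (A ◁ g) ∘ ((A ◁ f) ∘ x) = (A ◁ h) ∘ x.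
Proof. by move=> <- T x; rewrite whiskl_comp compA. Qed.

Lemma assoc_whiskr A A' B T (f : A ~> A') :
  α A' B T ∘ ((f ▷ B) ▷ T) = (f ▷ (B ⊗ T)) ∘ α A B T.
Proof. by rewrite assoc_nat tensm1. Qed.

Lemma assoc_whisk A B B' T (f : B ~> B') :
  α A B' T ∘ ((A ◁ f) ▷ T) = (A ◁ (f ▷ T)) ∘ α A B T.
Proof. by rewrite assoc_nat. Qed.

Lemma assoc_whiskl A B T T' (f : T ~> T') :
  α A B T' ∘ ((A ⊗ B) ◁ f) = (A ◁ (B ◁ f)) ∘ α A B T.
Proof. by rewrite -(tensm1 M) assoc_nat. Qed.

Lemma whiskl_one_inj A B (f g : A ~> B) : one ◁ f = one ◁ g -> f = g.
Proof.
by move=> E; apply: (fwd_epi (i := lunit M A)); rewrite -!(lunit_nat M) E.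
Qed.

Lemma whiskr_one_inj A B (f g : A ~> B) : f ▷ one = g ▷ one -> f = g.
Proof.
by move=> E; apply: (fwd_epi (i := runit M A)); rewrite -!(runit_nat M) E.
Qed.

(** The pentagon as a rule that brackets to the right. *)
Lemma assoc_flat A B B' T :
  (A ◁ α B B' T) ∘ (α A (B ⊗ B') T ∘ (α A B B' ▷ T))
  = α A B (B' ⊗ T) ∘ α (A ⊗ B) B' T.
Proof. by rewrite pentagon -compA. Qed.

(** Kelly's redundant coherence law: after tensoring on the left with the unit,
which is faithful, it follows from the pentagon for 1, 1, A, T and two
triangles. *)
Lemma lunit_flat A T : λ A ▷ T = λ (A ⊗ T) ∘ α one A T.
Proof.
apply: whiskl_one_inj.
apply: (fwd_epi (i := assoc M one (one ⊗ A) T)).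
apply: (fwd_epi (i := whiskr_iso T (assoc M one one A))) => /=.
rewrite -!compA (reassoc (esym (assoc_whisk _ _ _))) -compA -whiskr_comp.
rewrite triangle assoc_whiskr whiskl_comp -!compA assoc_flat.
by rewrite (reassoc (triangle M _ _)).
Qed.

Lemma runit_flat A T : ρ A ▷ T = (A ◁ λ T) ∘ α A one T.
Proof. by rewrite triangle. Qed.

(** Locked, as [cap], [swap] and [unswap] below, so that rewriting with laws of
composition does not look inside. *)
Definition cup A B (k : one ~> A ⊗ B) T : T ~> A ⊗ B ⊗ T :=
  locked (α A B T ∘ (k ▷ T) ∘ bwd (lunit M T)).

Definition cap A B (e : A ⊗ B ~> one) T : A ⊗ B ⊗ T ~> T :=
  locked (λ T ∘ (e ▷ T) ∘ bwd (assoc M A B T)).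

Lemma cup_def A B (k : one ~> A ⊗ B) T :
  cup k T ∘ λ T = α A B T ∘ (k ▷ T).
Proof. by rewrite /cup -?lock -!compA fwdK compm1. Qed.

Lemma cap_def A B (e : A ⊗ B ~> one) T :
  cap e T ∘ α A B T = λ T ∘ (e ▷ T).
Proof. by rewrite /cap -?lock -!compA fwdK compm1. Qed.

Lemma cup_whiskr A A' B (f : A ~> A') (k : one ~> A ⊗ B) T :
  cup ((f ▷ B) ∘ k) T = (f ▷ (B ⊗ T)) ∘ cup k T.
Proof. by rewrite /cup -?lock whiskr_comp !compA assoc_whiskr. Qed.

Lemma cup_whiskl A B B' (f : B ~> B') (k : one ~> A ⊗ B) T :
  cup ((A ◁ f) ∘ k) T = (A ◁ (f ▷ T)) ∘ cup k T.
Proof. by rewrite /cup -?lock whiskr_comp !compA assoc_whisk. Qed.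

Lemma cup_nat A B (k : one ~> A ⊗ B) T T' (f : T ~> T') :
  cup k T' ∘ f = (A ◁ (B ◁ f)) ∘ cup k T.
Proof.
apply: (fwd_epi (i := lunit M T)).
rewrite -!compA cup_def -(lunit_nat M) (reassoc (cup_def k T')) -compA.
by rewrite whisk_exchange compA assoc_whiskl -compA.
Qed.

Lemma cap_nat A B (e : A ⊗ B ~> one) T T' (f : T ~> T') :
  cap e T' ∘ (A ◁ (B ◁ f)) = f ∘ cap e T.
Proof.
apply: (fwd_epi (i := assoc M A B T)).
rewrite -!compA cap_def -assoc_whiskl (reassoc (cap_def e T')) -compA.
by rewrite whisk_exchange compA lunit_nat -compA.
Qed.

Lemma cup_inj A B (k k' : one ~> A ⊗ B) : cup k one = cup k' one -> k = k'.
Proof.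
move=> E; apply: whiskr_one_inj; apply: (fwd_mono (i := assoc M A B one)).
by rewrite -!cup_def E.
Qed.

(** The shape of the first triangle identity and of the double braid loop. *)
Lemma snaker_flat A B A' (k : one ~> A ⊗ B) (e : B ⊗ A' ~> one) T :
  (ρ A ∘ (A ◁ e) ∘ α A B A' ∘ (k ▷ A') ∘ bwd (lunit M A')) ▷ T
  = (A ◁ cap e T) ∘ cup k (A' ⊗ T).
Proof.
apply: (fwd_epi (i := whiskr_iso T (lunit M A'))) => /=.
rewrite -whiskr_comp -!compA fwdK compm1 lunit_flat.
rewrite (reassoc (cup_def _ _)) !whiskr_comp runit_flat -!compA.
rewrite (reassoc (assoc_whisk _ _ _)) -!compA.
rewrite (whiskl_eq (esym (cap_def e T))) whiskl_comp -!compA.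
by rewrite (reassoc3 (assoc_flat _ _ _ _)) -!compA assoc_whiskr.
Qed.



Lemma whiskr_fwd_bwd A B T (i : iso A B) X (x : X ~> B ⊗ T) :
  (fwd i ▷ T) ∘ ((bwd i ▷ T) ∘ x) = x.
Proof. exact: (fwd_bwd (whiskr_iso T i)). Qed.

(** The shape of the second triangle identity and of transposes. *)
Lemma snakel_flat A B D (e : A ⊗ B ~> one) (k : one ~> B ⊗ D) T :
  (λ D ∘ (e ▷ D) ∘ bwd (assoc M A B D) ∘ (A ◁ k) ∘ bwd (runit M A)) ▷ T
  = cap e (D ⊗ T) ∘ (A ◁ cup k T).
Proof.
apply: (fwd_epi (i := whiskr_iso T (runit M A))) => /=.
rewrite -whiskr_comp -!compA fwdK compm1 !whiskr_comp lunit_flat runit_flat.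
rewrite -!compA (reassoc (assoc_whiskr _ _ _)) -!compA.
rewrite (reassoc (esym (cap_def _ _))) -!compA.
rewrite (reassoc (esym (assoc_flat _ _ _ _))) -!compA whiskr_fwd_bwd.
by rewrite assoc_whisk (whiskl_eq (cup_def _ _)) whiskl_comp -!compA.
Qed.


Lemma cap_inj A B (e e' : A ⊗ B ~> one) : cap e one = cap e' one -> e = e'.
Proof.
move=> E; apply: whiskr_one_inj; apply: (fwd_mono (i := lunit M one)).
by rewrite -!cap_def E.
Qed.

Lemma cupE A B (k : one ~> A ⊗ B) T :
  cup k T = α A B T ∘ (k ▷ T) ∘ bwd (lunit M T).
Proof. by rewrite /cup -lock. Qed.

(** A cup inserted before S only affects the tail through its first factor, so it
is the cup before S ⊗ T. *)
Lemma cup_flat A B (k : one ~> A ⊗ B) S T :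
  (A ◁ α B S T) ∘ (α A (B ⊗ S) T ∘ (cup k S ▷ T)) = cup k (S ⊗ T).
Proof.
apply: (fwd_epi (i := whiskr_iso T (lunit M S))) => /=.
rewrite -!compA -whiskr_comp cup_def whiskr_comp.
rewrite (reassoc3 (assoc_flat _ _ _ _)) -compA assoc_whiskr lunit_flat.
by rewrite (reassoc (cup_def _ _)) compA.
Qed.

(** Bending B back with z recovers g from its action on k. *)
Lemma cup_faithful A B (k : one ~> A ⊗ B) (z : B ⊗ A ⊗ one ~> one) :
  (A ◁ z) ∘ cup k (A ⊗ one) = idm (A ⊗ one) ->
  forall A' (g g' : A ~> A'), (g ▷ B) ∘ k = (g' ▷ B) ∘ k -> g = g'.
Proof.
move=> Z A' g g' E; apply: whiskr_one_inj.
rewrite -(compm1 (g ▷ _)) -(compm1 (g' ▷ _)) -Z.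
rewrite !(reassoc (whisk_exchange _ _)) -!compA.
by rewrite -!cup_whiskr E.
Qed.

(** The pair k is the outer cup and l the inner one: W' comes before V', as it
must for W^∨ ⊗ V^∨ to be dual to V ⊗ W. *)
Definition nest V V' W W' (k : one ~> V ⊗ V') (l : one ~> W ⊗ W') :
    one ~> (V ⊗ W) ⊗ (W' ⊗ V') :=
  bwd (assoc M V W (W' ⊗ V')) ∘ ((V ◁ cup l V') ∘ k).

Lemma nest_flat V V' W W' (k : one ~> V ⊗ V') (l : one ~> W ⊗ W') T :
  (V ◁ (W ◁ α W' V' T)) ∘ (α V W ((W' ⊗ V') ⊗ T) ∘ cup (nest k l) T)
  = (V ◁ cup l (V' ⊗ T)) ∘ cup k T.
Proof.
apply: (fwd_epi (i := lunit M T)).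
rewrite -!compA !cup_def (reassoc (esym (assoc_flat _ _ _ _))) -compA.
rewrite /nest !whiskr_comp -compA whiskr_fwd_bwd.
rewrite (reassoc (assoc_whisk _ _ _)) -compA -(cup_flat l) !whiskl_comp.
by rewrite -!compA.
Qed.

Lemma nest_whiskr V V' W W' V1 W1 (k : one ~> V ⊗ V') (l : one ~> W ⊗ W')
    (f : V ~> V1) (g : W ~> W1) :
  nest ((f ▷ V') ∘ k) ((g ▷ W') ∘ l) = (tensm M f g ▷ (W' ⊗ V')) ∘ nest k l.
Proof.
apply: (fwd_mono (i := assoc M V1 W1 (W' ⊗ V'))).
rewrite (reassoc (assoc_nat M _ _ _)) /nest -!compA !fwd_bwd.
rewrite cup_whiskr whiskl_comp (tensm_whisk f (g ▷ _)) -!compA.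
by do 2 rewrite (reassoc (whisk_exchange f _)) -!compA.
Qed.

Lemma nest_whiskl V V' W W' V1 W1 (k : one ~> V ⊗ V') (l : one ~> W ⊗ W')
    (f : V' ~> V1) (g : W' ~> W1) :
  nest ((V ◁ f) ∘ k) ((W ◁ g) ∘ l) = ((V ⊗ W) ◁ tensm M g f) ∘ nest k l.
Proof.
apply: (fwd_mono (i := assoc M V W (W1 ⊗ V1))).
rewrite (reassoc (assoc_whiskl _ _ _)) /nest -!compA !fwd_bwd.
rewrite cup_whiskl whiskl_comp (tensm_whisk g f) !whiskl_comp -!compA.
by rewrite (whiskl_eq (cup_nat _ _)) whiskl_comp -!compA.
Qed.

(** * Braidings *)
Section Braided.
Variable c : braiding M.
Local Notation β A B := (fwd (c A B)).

Definition swap A B T : A ⊗ B ⊗ T ~> B ⊗ A ⊗ T :=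
  locked (α B A T ∘ (β A B ▷ T) ∘ bwd (assoc M A B T)).

Definition unswap A B T : B ⊗ A ⊗ T ~> A ⊗ B ⊗ T :=
  locked (α A B T ∘ (bwd (c A B) ▷ T) ∘ bwd (assoc M B A T)).

Lemma swap_def A B T : swap A B T ∘ α A B T = α B A T ∘ (β A B ▷ T).
Proof. by rewrite /swap -lock -!compA fwdK compm1. Qed.

Lemma unswap_def A B T :
  unswap A B T ∘ α B A T = α A B T ∘ (bwd (c A B) ▷ T).
Proof. by rewrite /unswap -lock -!compA fwdK compm1. Qed.

Lemma swapK A B T : unswap A B T ∘ swap A B T = idm (A ⊗ B ⊗ T).
Proof.
apply: (fwd_epi (i := assoc M A B T)).
rewrite -compA swap_def (reassoc (unswap_def _ _ _)) -compA -whiskr_comp.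
by rewrite fwdK tensm1 compm1 comp1m.
Qed.

Lemma unswapK A B T : swap A B T ∘ unswap A B T = idm (B ⊗ A ⊗ T).
Proof.
apply: (fwd_epi (i := assoc M B A T)).
rewrite -compA unswap_def (reassoc (swap_def _ _ _)) -compA -whiskr_comp.
by rewrite bwdK tensm1 compm1 comp1m.
Qed.

Definition swap_iso A B T : iso (A ⊗ B ⊗ T) (B ⊗ A ⊗ T) :=
  Iso (swap A B T) (unswap A B T) (swapK A B T) (unswapK A B T).

Lemma swap_nat A B T T' (f : T ~> T') :
  swap A B T' ∘ (A ◁ (B ◁ f)) = (B ◁ (A ◁ f)) ∘ swap A B T.
Proof.
apply: (fwd_epi (i := assoc M A B T)).
rewrite -!compA swap_def -assoc_whiskl (reassoc (swap_def _ _ _)) -compA.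
by rewrite whisk_exchange compA assoc_whiskl -compA.
Qed.

Lemma swap_whiskr A A' B T (f : A ~> A') :
  swap A' B T ∘ (f ▷ (B ⊗ T)) = (B ◁ (f ▷ T)) ∘ swap A B T.
Proof.
apply: (fwd_epi (i := assoc M A B T)).
rewrite -!compA swap_def -assoc_whiskr (reassoc (swap_def _ _ _)) -compA.
by rewrite -whiskr_comp braid_nat whiskr_comp compA assoc_whisk -compA.
Qed.

Lemma swap_whisk A B B' T (f : B ~> B') :
  swap A B' T ∘ (A ◁ (f ▷ T)) = (f ▷ (A ⊗ T)) ∘ swap A B T.
Proof.
apply: (fwd_epi (i := assoc M A B T)).
rewrite -!compA swap_def -assoc_whisk (reassoc (swap_def _ _ _)) -compA.
by rewrite -whiskr_comp braid_nat whiskr_comp compA assoc_whiskr -compA.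
Qed.

(** The hexagon for c_{A, B ⊗ D}. *)
Lemma swap_tensr A B D T :
  (B ◁ swap A D T) ∘ (swap A B (D ⊗ T) ∘ (A ◁ α B D T))
  = α B D (A ⊗ T) ∘ swap A (B ⊗ D) T.
Proof.
apply: (fwd_epi (i := assoc M A (B ⊗ D) T)).
apply: (fwd_epi (i := whiskr_iso T (assoc M A B D))) => /=.
rewrite -!compA assoc_flat (reassoc (swap_def _ _ _)) -compA.
rewrite (reassoc (swap_def _ _ _)) -compA.
rewrite (reassoc (esym (assoc_flat _ _ _ _))) -!compA -!whiskr_comp.
rewrite (compA (α B D A)) hexagon1 !whiskr_comp -!compA.
rewrite (reassoc (assoc_whisk _ _ _)) -compA.
rewrite (whiskl_eq (esym (swap_def _ _ _))) whiskl_comp -!compA.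
by rewrite (reassoc3 (assoc_flat _ _ _ _)) -!compA assoc_whiskr.
Qed.

(** The second hexagon, solved for c_{A ⊗ B, D}. *)
Lemma braid_tensl A B D :
  α D A B ∘ ((β A D ▷ B) ∘ (bwd (assoc M A D B) ∘ ((A ◁ β B D) ∘ α A B D)))
  = β (A ⊗ B) D.
Proof.
have -> : β (A ⊗ B) D
    = α D A B ∘ (bwd (assoc M D A B) ∘ β (A ⊗ B) D ∘ bwd (assoc M A B D)
      ∘ α A B D).
  by rewrite -!compA fwd_bwd fwdK compm1.
by rewrite hexagon2 -!compA.
Qed.

(** The hexagon for c_{A ⊗ B, D}. *)
Lemma swap_tensl A B D T :
  swap A D (B ⊗ T) ∘ ((A ◁ swap B D T) ∘ α A B (D ⊗ T))
  = (D ◁ α A B T) ∘ swap (A ⊗ B) D T.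
Proof.
apply: (fwd_epi (i := assoc M (A ⊗ B) D T)).
rewrite -!compA swap_def -braid_tensl !whiskr_comp.
rewrite (reassoc3 (assoc_flat _ _ _ _)) -!compA.
rewrite (reassoc (assoc_whiskr _ _ _)) -!compA.
rewrite (reassoc (esym (swap_def _ _ _))) -!compA.
rewrite (reassoc (esym (assoc_flat _ _ _ _))) -!compA whiskr_fwd_bwd.
rewrite (reassoc (assoc_whisk _ _ _)) -!compA.
by rewrite (whiskl_eq (esym (swap_def _ _ _))) whiskl_comp -!compA assoc_flat.
Qed.

Lemma lunit_lunit T : λ T ∘ (one ◁ λ T) = λ T ∘ λ (one ⊗ T).
Proof. by rewrite lunit_nat. Qed.

(** The hexagon for A and 1 ⊗ 1, compared with naturality along 1 ⊗ 1 -> 1, gives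
this for a tail of the form 1 ⊗ T; naturality in the tail removes the 1. *)
Lemma swap_unitr A T : λ (A ⊗ T) ∘ swap A one T = A ◁ λ T.
Proof.
have E : λ (A ⊗ one ⊗ T) ∘ swap A one (one ⊗ T) = A ◁ λ (one ⊗ T).
  apply: (fwd_mono (i := swap_iso A one T)).
  apply: (fwd_epi (i := whiskl_iso A (assoc M one one T))) => /=.
  rewrite -!compA (reassoc (esym (lunit_nat M (swap _ _ _)))) -compA.
  rewrite swap_tensr (reassoc (esym (lunit_flat _ _))) -swap_whisk.
  by rewrite -whiskl_comp -lunit_flat.
apply: (fwd_epi (i := whiskl_iso A (whiskl_iso one (lunit M T)))) => /=.
rewrite -whiskl_comp lunit_lunit -compA swap_nat.
by rewrite (reassoc (lunit_nat M _)) -compA E -whiskl_comp.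
Qed.

Lemma swap_unitl A T : (A ◁ λ T) ∘ swap one A T = λ (A ⊗ T).
Proof.
have E : (A ◁ λ (one ⊗ T)) ∘ swap one A (one ⊗ T) = λ (A ⊗ one ⊗ T).
  apply: (fwd_epi (i := whiskl_iso one (swap_iso one A T))).
  apply: (fwd_epi (i := assoc M one one (A ⊗ T))) => /=.
  rewrite -!compA swap_tensl (reassoc (esym (whiskl_comp _ _ _))) -lunit_flat.
  by rewrite -swap_whiskr (reassoc (lunit_nat M _)) -compA -lunit_flat.
apply: (fwd_epi (i := whiskl_iso one (whiskl_iso A (lunit M T)))) => /=.
rewrite -compA swap_nat (reassoc (esym (whiskl_comp _ _ _))) lunit_lunit.
by rewrite whiskl_comp -compA E lunit_nat.
Qed.

Lemma yang_baxter A B D T :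
  (D ◁ swap A B T) ∘ (swap A D (B ⊗ T) ∘ (A ◁ swap B D T))
  = swap B D (A ⊗ T) ∘ ((B ◁ swap A D T) ∘ swap A B (D ⊗ T)).
Proof.
apply: (fwd_epi (i := assoc M A B (D ⊗ T))).
rewrite -!compA swap_tensl swap_def (whiskl_eq (swap_def _ _ _)) whiskl_comp.
rewrite -compA -swap_whiskr (reassoc (esym (swap_tensl _ _ _ _))) -!compA.
by [].
Qed.

(** Naturality of the braiding c_{-, V} with respect to e.  The next two lemmas
are its analogues for a cup and c_{V, -} or c_{-, V}. *)
Lemma cap_swap A B V (e : A ⊗ B ~> one) T :
  (V ◁ cap e T) ∘ (swap A V (B ⊗ T) ∘ (A ◁ swap B V T)) = cap e (V ⊗ T).
Proof.
apply: (fwd_epi (i := assoc M A B (V ⊗ T))).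
rewrite -!compA swap_tensl (whiskl_eq (cap_def _ _)) whiskl_comp -compA.
by rewrite -swap_whiskr (reassoc (swap_unitl _ _)) cap_def.
Qed.

Lemma swap_cupr A B V (k : one ~> A ⊗ B) T :
  (A ◁ swap V B T) ∘ (swap V A (B ⊗ T) ∘ (V ◁ cup k T)) = cup k (V ⊗ T).
Proof.
apply: (fwd_epi (i := whiskl_iso V (lunit M T))) => /=.
rewrite -!compA -whiskl_comp cup_def whiskl_comp.
rewrite (reassoc3 (swap_tensr _ _ _ _)) -compA swap_whisk.
by rewrite -swap_unitr !compA cup_def.
Qed.

Lemma swap_cupl A B V (k : one ~> A ⊗ B) T :
  swap A V (B ⊗ T) ∘ ((A ◁ swap B V T) ∘ cup k (V ⊗ T)) = V ◁ cup k T.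
Proof.
apply: (fwd_epi (i := lunit M (V ⊗ T))).
rewrite -!compA cup_def (reassoc3 (swap_tensl _ _ _ _)) -compA swap_whiskr.
rewrite (reassoc (esym (whiskl_comp _ _ _))) -cup_def whiskl_comp -compA.
by rewrite swap_unitl.
Qed.


Lemma cup_braid A B (k : one ~> A ⊗ B) T :
  cup (β A B ∘ k) T = swap A B T ∘ cup k T.
Proof.
by rewrite !cupE whiskr_comp !compA swap_def.
Qed.

(** Crossing the outer legs of two nested cups is the same as nesting them the
other way and crossing the inner legs.  After one more swap of V and W', which
is invertible, both sides become two cups side by side. *)
Lemma cup_cross V V' W W' (k : one ~> V ⊗ V') (l : one ~> W ⊗ W') T :
  swap V W (W' ⊗ V' ⊗ T) ∘ ((V ◁ cup l (V' ⊗ T)) ∘ cup k T)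
  = (W ◁ (V ◁ swap V' W' T)) ∘ ((W ◁ cup k (W' ⊗ T)) ∘ cup l T).
Proof.
apply: (fwd_mono (i := whiskl_iso W (swap_iso V W' (V' ⊗ T)))) => /=.
rewrite (reassoc3 (swap_cupr _ _ _)) cup_nat.
by do 2 rewrite (whiskl_eq (erefl _)); rewrite -compA swap_cupl.
Qed.

Lemma nest_braid V V' W W' (k : one ~> V ⊗ V') (l : one ~> W ⊗ W') :
  (β V W ▷ (W' ⊗ V')) ∘ nest k l = ((W ⊗ V) ◁ β V' W') ∘ nest l k.
Proof.
apply: cup_inj; apply: (fwd_mono (i := assoc M W V _)).
apply: (fwd_mono (i := whiskl_iso W (whiskl_iso V (assoc M W' V' one)))) => /=.
rewrite cup_whiskr cup_whiskl (reassoc (esym (swap_def _ _ _))) -compA.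
rewrite (reassoc (esym (swap_nat _ _ _))) -compA nest_flat.
rewrite (reassoc (assoc_whiskl _ _ _)) -compA.
rewrite (whiskl_eq (esym (whiskl_comp _ _ _))) -swap_def whiskl_comp.
by rewrite whiskl_comp -compA nest_flat cup_cross.
Qed.

(** Each use of [nest_braid] exchanges the two cups, so that after two of them
they are nested as before. *)
Lemma nest_monodromy V V' W W' (k : one ~> V ⊗ V') (l : one ~> W ⊗ W') :
  ((β W V ∘ β V W) ▷ (W' ⊗ V')) ∘ nest k l
  = ((V ⊗ W) ◁ (β V' W' ∘ β W' V')) ∘ nest k l.
Proof.
rewrite whiskr_comp whiskl_comp -!compA nest_braid.
by rewrite (reassoc (whisk_exchange _ _)) -compA nest_braid.
Qed.

Lemma monodromy_nat A A' B B' (f : A ~> A') (g : B ~> B') :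
  β B' A' ∘ (β A' B' ∘ tensm M f g) = tensm M f g ∘ (β B A ∘ β A B).
Proof. by rewrite braid_nat compA braid_nat compA. Qed.

(** Both sides are the full twist on three strands, and four applications of the
Yang-Baxter equation bring them to the same word. *)
Lemma monodromy_assoc A B E :
  α A B E ∘ ((β B A ▷ E) ∘ ((β A B ▷ E) ∘ (β E (A ⊗ B) ∘ β (A ⊗ B) E)))
  = (A ◁ β E B) ∘ ((A ◁ β B E) ∘ (β (B ⊗ E) A ∘ (β A (B ⊗ E) ∘ α A B E))).
Proof.
apply: whiskr_one_inj; apply: (fwd_mono (i := assoc M A (B ⊗ E) one)).
apply: (fwd_mono (i := whiskl_iso A (assoc M B E one))) => /=.
rewrite !whiskr_comp (reassoc3 (assoc_flat _ _ _ _)) -compA.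
do 2 rewrite (reassoc (assoc_whiskr _ _ _)) -compA.
do 2 rewrite (reassoc (esym (swap_def _ _ _))) -compA.
rewrite (reassoc (esym (swap_def _ (A ⊗ B) _))) -!compA -swap_def.
rewrite (reassoc (esym (swap_tensr _ _ _ _))) -!compA.
rewrite (reassoc (esym (swap_tensl _ _ _ _))) -!compA.
do 2 rewrite (reassoc (assoc_whisk _ _ _)) -compA
  (whiskl_eq (esym (swap_def _ _ _))) whiskl_comp -compA.
do 2 rewrite (reassoc (esym (swap_def _ _ _))) -compA.
rewrite (reassoc (esym (swap_tensl _ _ _ _))) -!compA.
rewrite (reassoc (esym (swap_tensr _ _ _ _))) -!compA assoc_flat.
rewrite (reassoc3 (esym (yang_baxter E A B _))) -!compA.
rewrite (reassoc3 (yang_baxter A B E _)) -!compA.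
rewrite (reassoc3 (yang_baxter B E A _)) -!compA.
by rewrite (reassoc3 (yang_baxter E B A _)) -!compA.
Qed.

Lemma braid_unitr A : λ A ∘ β A one = ρ A.
Proof.
apply: whiskr_one_inj.
by rewrite whiskr_comp lunit_flat -compA -swap_def compA swap_unitr runit_flat.
Qed.

Lemma braid_unitl A : ρ A ∘ β one A = λ A.
Proof.
apply: whiskr_one_inj.
by rewrite whiskr_comp runit_flat -compA -swap_def compA swap_unitl lunit_flat.
Qed.

Lemma monodromy_unit A : β one A ∘ β A one = idm (A ⊗ one).
Proof.
apply: (fwd_mono (i := runit M A)).
by rewrite compA braid_unitl braid_unitr compm1.
Qed.

(** * The balanced structure on pairs of an object and an endomorphism *)
Definition tens_twist A B (h : A ~> A) (k : B ~> B) : A ⊗ B ~> A ⊗ B :=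
  tensm M h k ∘ β B A ∘ β A B.

Lemma tens_twist_nat A A' B B' h h' k k' (f : A ~> A') (g : B ~> B') :
  intertwines h h' f -> intertwines k k' g ->
  intertwines (tens_twist h k) (tens_twist h' k') (tensm M f g).
Proof.
rewrite /intertwines /tens_twist => F G.
rewrite -!compA monodromy_nat (reassoc (esym (tensm_comp M _ _ _ _))) F G.
by rewrite tensm_comp -compA.
Qed.

Lemma tens_twist_whiskl A B B' h k k' (g : B ~> B') :
  intertwines k k' g ->
  intertwines (tens_twist h k) (tens_twist h k') (A ◁ g).
Proof. by apply: tens_twist_nat; rewrite /intertwines compm1 comp1m. Qed.

Lemma tens_twist_whiskr A A' B h h' k (f : A ~> A') :
  intertwines h h' f ->
  intertwines (tens_twist h k) (tens_twist h' k) (f ▷ B).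
Proof.
by move=> F; apply: tens_twist_nat => //; rewrite /intertwines compm1 comp1m.
Qed.

Lemma tens_twist_braid A B h k :
  intertwines (tens_twist h k) (tens_twist k h) (β A B).
Proof.
by rewrite /intertwines /tens_twist -!compA (reassoc (braid_nat _ _ _)) -!compA.
Qed.

Lemma tens_twist_lunit A h :
  intertwines (tens_twist (idm one) h) h (λ A).
Proof.
rewrite /intertwines /tens_twist -!compA (reassoc (lunit_nat M _)) -compA.
by rewrite (reassoc (braid_unitr _)) braid_unitl.
Qed.

Lemma tens_twist_runit A h :
  intertwines (tens_twist h (idm one)) h (ρ A).
Proof.
rewrite /intertwines /tens_twist -!compA (reassoc (runit_nat M _)) -compA.
by rewrite (reassoc (braid_unitl _)) braid_unitr.
Qed.

Lemma tens_twist_assoc A B E h k l :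
  intertwines (tens_twist (tens_twist h k) l) (tens_twist h (tens_twist k l))
    (α A B E).
Proof.
rewrite /intertwines /tens_twist.
have -> : tensm M h (tensm M k l ∘ β E B ∘ β B E)
    = tensm M h (tensm M k l) ∘ (A ◁ β E B) ∘ (A ◁ β B E).
  by rewrite -!tensm_comp !compm1.
have -> : tensm M (tensm M h k ∘ β B A ∘ β A B) l
    = tensm M (tensm M h k) l ∘ (β B A ▷ E) ∘ (β A B ▷ E).
  by rewrite -!tensm_comp !compm1.
by rewrite -!compA (reassoc (assoc_nat M _ _ _)) -compA monodromy_assoc.
Qed.

Lemma cup_intertwines A B (k : one ~> A ⊗ B) h h' V (l : V ~> V) :
  intertwines (idm one) (tens_twist h h') k ->
  intertwines l (tens_twist h (tens_twist h' l)) (cup k V).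
Proof.
move=> K; rewrite cupE.
apply: intertwines_comp (intertwines_bwd (tens_twist_lunit _)).
apply: intertwines_comp (tens_twist_assoc _ _ _) _.
exact: tens_twist_whiskr.
Qed.

Lemma nest_intertwines V V' W W' (k : one ~> V ⊗ V') (l : one ~> W ⊗ W')
    h h' g g' :
  intertwines (idm one) (tens_twist h h') k ->
  intertwines (idm one) (tens_twist g g') l ->
  intertwines (idm one) (tens_twist (tens_twist h g) (tens_twist g' h'))
    (nest k l).
Proof.
move=> K L; apply: intertwines_comp.
  exact: intertwines_bwd (tens_twist_assoc _ _ _).
exact: intertwines_comp (tens_twist_whiskl _ (cup_intertwines _ L)) K.
Qed.


(** * Duals and the half twist condition *)
Section Rigid.
Variables (dual : C -> C) (D : left_rigid M dual).
Local Notation ev V := (ev D V).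
Local Notation coev V := (coev D V).

Lemma zigzag_flat V T :
  (V ◁ cap (ev V) T) ∘ cup (coev V) (V ⊗ T) = idm (V ⊗ T).
Proof. by rewrite -snaker_flat zigzag1 tensm1. Qed.

Lemma zagzig_flat V T :
  cap (ev V) (dual V ⊗ T) ∘ (dual V ◁ cup (coev V) T) = idm (dual V ⊗ T).
Proof. by rewrite -snakel_flat zigzag2 tensm1. Qed.

(** Half of the universal property of the coevaluation: every map 1 -> U ⊗ P
comes from coev_U through this map. *)
Definition coev_factor U P (k : one ~> U ⊗ P) : dual U ~> P :=
  λ P ∘ (ev U ▷ P) ∘ bwd (assoc M (dual U) U P) ∘ (dual U ◁ k)
    ∘ bwd (runit M (dual U)).

Lemma coev_factorK U P (k : one ~> U ⊗ P) : (U ◁ coev_factor k) ∘ coev U = k.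
Proof.
apply: cup_inj.
rewrite cup_whiskl snakel_flat whiskl_comp -compA -cup_nat.
by rewrite compA zigzag_flat comp1m.
Qed.

(** This characterises the transpose, by [coev_injr]. *)
Lemma coev_transpose V W (f : V ~> W) :
  (W ◁ transpose D f) ∘ coev W = (f ▷ dual V) ∘ coev V.
Proof.
rewrite -[RHS](coev_factorK) /transpose /coev_factor.
by rewrite !(whiskl_comp _ _ (coev V)) -!compA.
Qed.

Lemma coev_injl U : forall V (g g' : U ~> V),
  (g ▷ dual U) ∘ coev U = (g' ▷ dual U) ∘ coev U -> g = g'.
Proof. exact: cup_faithful (zigzag_flat _ _). Qed.

Lemma coev_injr U P (g g' : dual U ~> P) :
  (U ◁ g) ∘ coev U = (U ◁ g') ∘ coev U -> g = g'.
Proof.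
move=> E; apply: whiskr_one_inj.
rewrite -(compm1 (g ▷ _)) -(compm1 (g' ▷ _)) -(zagzig_flat U one).
by rewrite !compA -!cap_nat -!compA -!whiskl_comp -!cup_whiskl E.
Qed.

Lemma transpose1 V : transpose D (idm V) = idm (dual V).
Proof. by apply: coev_injr; rewrite coev_transpose. Qed.

Lemma transpose_comp V W Z (g : W ~> Z) (f : V ~> W) :
  transpose D (g ∘ f) = transpose D f ∘ transpose D g.
Proof.
apply: coev_injr; rewrite coev_transpose whiskl_comp -compA coev_transpose.
rewrite (reassoc (esym (whisk_exchange _ _))) -compA coev_transpose.
by rewrite whiskr_comp compA.
Qed.

Lemma transpose_iso_subproof V W (i : iso V W) :
  transpose D (fwd i) ∘ transpose D (bwd i) = idm (dual V).
Proof. by rewrite -transpose_comp fwdK transpose1. Qed.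

Definition transpose_iso V W (i : iso V W) : iso (dual W) (dual V) :=
  Iso (transpose D (fwd i)) (transpose D (bwd i))
    (transpose_iso_subproof (iso_inv i)) (transpose_iso_subproof i).

Lemma snaker_coev V (k : one ~> V ⊗ dual V) :
  ((ρ V ∘ (V ◁ ev V) ∘ α V (dual V) V ∘ (k ▷ V) ∘ bwd (lunit M V)) ▷ dual V)
    ∘ coev V = k.
Proof.
apply: cup_inj.
rewrite cup_whiskr snaker_flat -compA cup_nat.
by rewrite (reassoc (esym (whiskl_comp _ _ _))) zagzig_flat tensm1 comp1m.
Qed.

(** The loop bends the second leg of c c coev_V back to V with ev_V; bending it
once more with coev_V straightens it out. *)
Lemma loop_coev V :
  (double_braid_loop c D V ▷ dual V) ∘ coev V
  = β (dual V) V ∘ (β V (dual V) ∘ coev V).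
Proof. by rewrite /double_braid_loop snaker_coev compA. Qed.

(** Naturality of c_{-, V} along ev_V ([cap_swap]) expresses
(1 ⊗ ev) (c_{V^∨, V} ⊗ 1) as (ev ⊗ 1) (1 ⊗ c_{V, V}^{-1}), which turns one
loop into the other. *)
Lemma loops_eq V : double_braid_loop c D V = inverse_braid_loop c D V.
Proof.
apply: whiskr_one_inj.
rewrite /double_braid_loop snaker_flat -compA !cup_braid.
apply: (fwd_epi (i := whiskr_iso one (lunit M V))) => /=.
rewrite /inverse_braid_loop -[RHS]whiskr_comp -!compA fwdK compm1.
rewrite !whiskr_comp lunit_flat -compA (reassoc (assoc_whiskr _ _ _)) -!compA.
rewrite (reassoc (esym (cap_def _ _))) -compA.
rewrite (reassoc (esym (assoc_flat _ _ _ _))) -!compA whiskr_fwd_bwd.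
rewrite (reassoc (assoc_whisk _ _ _)) -compA.
rewrite (whiskl_eq (esym (unswap_def _ _ _))) whiskl_comp -compA.
rewrite (reassoc3 (assoc_flat _ _ _ _)) -compA.
rewrite (reassoc (assoc_whiskr _ _ _)) -compA assoc_whiskr.
rewrite (reassoc (esym (swap_def _ _ _))) -compA.
rewrite (reassoc (esym (cup_def _ _))) -cap_swap -!compA.
by rewrite (whiskl_eq (unswapK _ _ _)) tensm1 comp1m.
Qed.

Lemma loop_universal U P (k : one ~> U ⊗ P) :
  (double_braid_loop c D U ▷ P) ∘ k = β P U ∘ (β U P ∘ k).
Proof.
rewrite -(coev_factorK k) (reassoc (whisk_exchange _ _)) -compA loop_coev.
by rewrite (reassoc (braid_nat _ _ _)) -compA (reassoc (braid_nat _ _ _)) -compA.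
Qed.

(** The criterion by which the unit, tensor products and duals are seen to
satisfy the half twist condition. *)
Lemma half_twistI U P (i : iso U U) (k : one ~> U ⊗ P) (p : P ~> P) :
  (forall g : U ~> U, (g ▷ P) ∘ k = (idm U ▷ P) ∘ k -> g = idm U) ->
  (fwd i ▷ P) ∘ k = (U ◁ p) ∘ k ->
  intertwines (idm one) (tens_twist (fwd i) p) k ->
  half_twist c D (fwd i).
Proof.
rewrite /intertwines /tens_twist compm1 => faith adj inv.
have E : fwd i ∘ (fwd i ∘ double_braid_loop c D U) = idm U.
  apply: faith; rewrite !(whiskr_comp _ (fwd i)) -!compA loop_universal.
  rewrite tensm1 comp1m.
  (* cancelling h ⊗ 1 leaves c c (h ⊗ 1) k = c c (1 ⊗ p) k *)
  rewrite -[RHS]inv (tensm_whisk (fwd i) p) -!compA; congr (_ ∘ _).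
  rewrite (compA (β P U)) !(reassoc (esym (monodromy_nat _ _))) -!compA.
  by rewrite adj.
exists i; split=> //; last exact: loops_eq.
by do 2 apply: (fwd_mono (i := i)); rewrite fwd_bwd bwdK E.
Qed.

(** The factor h h coming from h ⊗ h^∨ cancels the loop, which is h^{-2}. *)
Lemma half_twist_coev V (h : V ~> V) :
  half_twist c D h ->
  intertwines (idm one) (tens_twist h (transpose D h)) (coev V).
Proof.
case=> i [<- loopE _]; rewrite /intertwines /tens_twist compm1 -!compA.
rewrite -loop_coev -loopE (tensm_whisk _ (transpose D _)) -compA.
rewrite (reassoc (esym (whisk_exchange _ _))) -compA coev_transpose.
rewrite !(reassoc (esym (whiskr_comp _ _ _))) -!compA fwdK compm1 bwdK.
by rewrite tensm1 comp1m.
Qed.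

(** By the second triangle identity for ev_V, bending both ends of e around with
coev_V and ev_V gives e back, while the hypothesis turns the result into ev_V. *)
Lemma ev_unique V (e : dual V ⊗ V ~> one) :
  ρ V ∘ ((V ◁ e) ∘ cup (coev V) V) = idm V -> e = ev V.
Proof.
rewrite cupE !compA => E; apply: cap_inj.
have Z : (V ◁ cap e one) ∘ cup (coev V) (V ⊗ one) = idm (V ⊗ one).
  by rewrite -snaker_flat E tensm1.
rewrite -(compm1 (cap e one)) -(zagzig_flat V (V ⊗ one)) compA -cap_nat.
by rewrite -compA -whiskl_comp Z tensm1 compm1.
Qed.

(** Apply h to the triangle identity for ev n, where n is the automorphism of
V^∨ ⊗ V.  The double braid of V is natural along ev and trivial at the unit, so
h ⊗ ev n is 1 ⊗ ev after the automorphism of V ⊗ (V^∨ ⊗ V), and the latter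
moves past the compatible cup and becomes h. *)
Lemma half_twist_ev V (h : V ~> V) :
  half_twist c D h -> intertwines (tens_twist (transpose D h) h) (idm one) (ev V).
Proof.
move=> Hh; rewrite /intertwines comp1m.
have [i [Ei _ _]] := Hh; symmetry; apply: ev_unique.
set n := tens_twist _ _.
have Z : ρ V ∘ ((V ◁ ev V) ∘ cup (coev V) V) = idm V.
  by rewrite cupE -[RHS](zigzag1 D) -!compA.
have K := cup_intertwines h (half_twist_coev Hh).
apply: (fwd_mono (i := i)); rewrite Ei compm1.
have T : (V ◁ (ev V ∘ n)) ∘ (h ▷ (dual V ⊗ V)) = (V ◁ ev V) ∘ tens_twist h n.
  rewrite [tens_twist h n]/tens_twist -!compA.
  rewrite (reassoc (esym (tensm_comp M _ _ _ _))) -monodromy_nat.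
  by rewrite (reassoc (monodromy_unit _)) !comp1m -tensm_comp compm1 comp1m.
rewrite (reassoc (esym (runit_nat M h))) -!compA.
rewrite (reassoc (whisk_exchange _ _)) T -compA K.
by rewrite (compA _ _ h) (compA _ _ h) Z comp1m.
Qed.


(** The tail V ⊗ W is consumed from the left: V^∨ is evaluated against V, which
leaves W^∨ next to W. *)
Lemma nest_coev_injl V W : forall Z (g g' : V ⊗ W ~> Z),
  (g ▷ (dual W ⊗ dual V)) ∘ nest (coev V) (coev W)
    = (g' ▷ (dual W ⊗ dual V)) ∘ nest (coev V) (coev W) ->
  g = g'.
Proof.
pose z := cap (ev W) one ∘ ((dual W ◁ cap (ev V) (W ⊗ one))
  ∘ (α (dual W) (dual V) (V ⊗ W ⊗ one) ∘ ((dual W ⊗ dual V) ◁ α V W one))).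
apply: (cup_faithful (z := z)).
apply: (fwd_mono (i := assoc M V W one)).
rewrite (reassoc (assoc_whiskl _ _ _)) /z !whiskl_comp -!compA.
rewrite (reassoc (esym (assoc_whiskl _ _ _))) -compA -cup_nat.
rewrite (reassoc3 (nest_flat _ _ _)) -!compA.
rewrite (whiskl_eq (esym (cup_nat _ _))) whiskl_comp -compA.
rewrite (whiskl_eq (zigzag_flat _ _)) tensm1 comp1m.
by rewrite (reassoc (zigzag_flat _ _)) comp1m compm1.
Qed.

Lemma half_twist_tens V W (h : V ~> V) (k : W ~> W) :
  half_twist c D h -> half_twist c D k -> half_twist c D (tens_twist h k).
Proof.
move=> Hh Hk; have [i [Ei _ _]] := Hh; have [j [Ej _ _]] := Hk.
have -> : tens_twist h k
    = fwd (iso_comp (iso_comp (tens_iso i j) (c W V)) (c V W)).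
  by rewrite /= Ei Ej.
apply: (half_twistI (k := nest (coev V) (coev W))
  (p := tens_twist (transpose D k) (transpose D h))) => /=.
- by move=> g; apply: nest_coev_injl.
- rewrite Ei Ej -!compA whiskr_comp -compA nest_monodromy.
  rewrite (reassoc (whisk_exchange _ _)) -compA -nest_whiskr -!coev_transpose.
  rewrite nest_whiskl (reassoc (esym (whiskl_comp _ _ _))).
  by rewrite /tens_twist -!compA -monodromy_nat.
- rewrite Ei Ej; apply: nest_intertwines; exact: half_twist_coev.
Qed.

(** A double braid with the unit is trivial, so coev_1 is compatible with
identities. *)
Lemma half_twist_one : half_twist c D (idm one).
Proof.
apply: (half_twistI (i := id_iso one) (k := coev one) (p := idm _)) => //=.
  by move=> g; apply: coev_injl.
rewrite /intertwines /tens_twist tensm1 comp1m compm1.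
apply: (fwd_mono (i := c one (dual one))).
by rewrite -!compA (reassoc (monodromy_unit _)) comp1m.
Qed.

Lemma half_twist_transpose V (h : V ~> V) :
  half_twist c D h -> half_twist c D (transpose D h).
Proof.
move=> Hh; have [i [Ei _ _]] := Hh.
have -> : transpose D h = fwd (transpose_iso i) by rewrite /= Ei.
apply: (half_twistI (k := β V (dual V) ∘ coev V) (p := h)) => /=.
- move=> g; rewrite !(reassoc (esym (braid_nat _ _ _))) -!compA => E.
  exact: coev_injr (fwd_mono E).
- rewrite Ei !(reassoc (esym (braid_nat _ _ _))) -!compA coev_transpose.
  by [].
- rewrite Ei; apply: intertwines_comp (tens_twist_braid _ _) _.
  exact: half_twist_coev.
Qed.

End Rigid.
End Braided.
End Monoidal.

(** * The ribbon category *)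
Section RibbonCategory.
Variables (C : category) (tens : C -> C -> C) (one : C).
Variables (M : monoidal tens one) (c : braiding M).
Variables (dual : C -> C) (D : left_rigid M dual).
Local Notation R := (rib_cat c D).

Lemma rib_iso_fwdK (X Y : R) (i : iso (rib_carrier X) (rib_carrier Y))
    (H : intertwines (rib_eta X) (rib_eta Y) (fwd i)) :
  (RibHom (intertwines_bwd H) : (Y : R) ~> X) ∘ (RibHom H : X ~> Y) = idm X.
Proof. by apply: rib_hom_eq; apply: fwdK. Qed.

Lemma rib_iso_bwdK (X Y : R) (i : iso (rib_carrier X) (rib_carrier Y))
    (H : intertwines (rib_eta X) (rib_eta Y) (fwd i)) :
  (RibHom H : X ~> Y) ∘ (RibHom (intertwines_bwd H) : Y ~> X) = idm Y.
Proof. by apply: rib_hom_eq; apply: bwdK. Qed.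

Definition rib_iso (X Y : R) (i : iso (rib_carrier X) (rib_carrier Y))
    (H : intertwines (rib_eta X) (rib_eta Y) (fwd i)) : iso X Y :=
  Iso (RibHom H : X ~> Y) (RibHom (intertwines_bwd H) : Y ~> X)
    (rib_iso_fwdK H) (rib_iso_bwdK H).

Definition rib_tens (X Y : R) : R :=
  RibObj (tens (rib_carrier X) (rib_carrier Y)) (tens_eta X Y)
    (half_twist_tens (rib_etaP X) (rib_etaP Y)).

Definition rib_one : R := RibObj one (idm one) (half_twist_one c D).

Definition rib_dual (X : R) : R :=
  RibObj (dual (rib_carrier X)) (transpose D (rib_eta X))
    (half_twist_transpose (rib_etaP X)).

Definition rib_tensm (X Y X' Y' : R) (f : X ~> X') (g : Y ~> Y') :
    rib_tens X Y ~> rib_tens X' Y' :=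
  @RibHom _ _ _ _ _ _ _ (rib_tens X Y) (rib_tens X' Y')
    (tensm M (rib_mor f) (rib_mor g))
    (tens_twist_nat c (rib_morP f) (rib_morP g)).

Definition rib_assoc (X Y Z : R) :
    iso (rib_tens (rib_tens X Y) Z) (rib_tens X (rib_tens Y Z)) :=
  rib_iso (tens_twist_assoc c (rib_eta X) (rib_eta Y) (rib_eta Z)
    : intertwines (rib_eta (rib_tens (rib_tens X Y) Z))
        (rib_eta (rib_tens X (rib_tens Y Z))) _).

Definition rib_lunit (X : R) : iso (rib_tens rib_one X) X :=
  rib_iso (tens_twist_lunit c (rib_eta X)
    : intertwines (rib_eta (rib_tens rib_one X)) (rib_eta X) _).

Definition rib_runit (X : R) : iso (rib_tens X rib_one) X :=
  rib_iso (tens_twist_runit c (rib_eta X)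
    : intertwines (rib_eta (rib_tens X rib_one)) (rib_eta X) _).

Definition rib_monoidal_struct : monoidal rib_tens rib_one.
Proof.
refine (@Monoidal R rib_tens rib_one rib_tensm _ _ rib_assoc rib_lunit
  rib_runit _ _ _ _ _); move=> *; apply: rib_hom_eq.
- exact: tensm1.
- exact: tensm_comp.
- exact: assoc_nat.
- exact: lunit_nat.
- exact: runit_nat.
- exact: pentagon.
- exact: triangle.
Defined.

Definition rib_braid (X Y : R) : iso (rib_tens X Y) (rib_tens Y X) :=
  rib_iso (tens_twist_braid c (rib_eta X) (rib_eta Y)
    : intertwines (rib_eta (rib_tens X Y)) (rib_eta (rib_tens Y X)) _).

Definition rib_braiding_struct : braiding rib_monoidal_struct.
Proof.
refine (@Braiding R rib_tens rib_one rib_monoidal_struct rib_braid _ _ _);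
  move=> *; apply: rib_hom_eq.
- exact: braid_nat.
- exact: hexagon1.
- exact: hexagon2.
Defined.

Definition rib_ev (X : R) : rib_tens (rib_dual X) X ~> rib_one :=
  @RibHom _ _ _ _ _ _ _ (rib_tens (rib_dual X) X) rib_one
    (ev D (rib_carrier X)) (half_twist_ev (rib_etaP X)).

Definition rib_coev (X : R) : rib_one ~> rib_tens X (rib_dual X) :=
  @RibHom _ _ _ _ _ _ _ rib_one (rib_tens X (rib_dual X))
    (coev D (rib_carrier X)) (half_twist_coev (rib_etaP X)).

Definition rib_rigid_struct : left_rigid rib_monoidal_struct rib_dual.
Proof.
refine (@LeftRigid R rib_tens rib_one rib_monoidal_struct rib_dual rib_ev
  rib_coev _ _); move=> X; apply: rib_hom_eq.
- exact: zigzag1.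
- exact: zigzag2.
Defined.

Lemma half_twistKr V (h : V ~> V) :
  half_twist c D h -> h ∘ (h ∘ double_braid_loop c D V) = idm V.
Proof. by case=> i [<- <- _]; rewrite fwd_bwd bwdK. Qed.

Lemma half_twistKl V (h : V ~> V) :
  half_twist c D h -> h ∘ double_braid_loop c D V ∘ h = idm V.
Proof. by case=> i [<- <- _]; rewrite fwd_bwd fwdK. Qed.

(** The half twist condition only asserts that an inverse exists; this formula
provides it as data. *)
Definition half_twist_iso V (h : V ~> V) (H : half_twist c D h) : iso V V :=
  Iso h (h ∘ double_braid_loop c D V) (half_twistKl H) (half_twistKr H).

Definition rib_twist_iso (X : R) : iso X X :=
  @rib_iso X X (half_twist_iso (rib_etaP X)) (erefl _).

Definition rib_balancing : balancing rib_braiding_struct.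
Proof.
refine (@Balancing R rib_tens rib_one rib_monoidal_struct rib_braiding_struct
  rib_twist_iso _ _).
- by move=> X Y f; apply: rib_hom_eq; apply: rib_morP.
- by move=> X Y; apply: rib_hom_eq.
Defined.

Definition rib_ribbon : ribbon rib_tens rib_one rib_dual.
Proof.
refine (@Ribbon R rib_tens rib_one rib_dual rib_monoidal_struct
  rib_braiding_struct rib_rigid_struct rib_balancing _).
by move=> X; apply: rib_hom_eq.
Defined.

End RibbonCategory.

Theorem theorem5p2 (C : category) (tens : C -> C -> C) (one : C)
    (M : monoidal tens one) (c : braiding M)
    (dual : C -> C) (D : left_rigid M dual) :
  exists (tens_ok : forall X Y : rib_cat c D, half_twist c D (tens_eta X Y))
         (one_ok : half_twist c D (idm one))
         (dual_ok : forall X : rib_cat c D,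
                      half_twist c D (transpose D (rib_eta X))),
  let rtens (X Y : rib_cat c D) : rib_cat c D :=
    RibObj (tens (rib_carrier X) (rib_carrier Y)) (tens_eta X Y)
           (tens_ok X Y) in
  let rone : rib_cat c D := RibObj one (idm one) one_ok in
  let rdual (X : rib_cat c D) : rib_cat c D :=
    RibObj (dual (rib_carrier X)) (transpose D (rib_eta X)) (dual_ok X) in
  exists S : ribbon rtens rone rdual,
    (forall (X Y X' Y' : rib_cat c D) (f : X ~> X') (g : Y ~> Y'),
        rib_mor (tensm (rib_monoidal S) f g)
        = tensm M (rib_mor f) (rib_mor g))
    /\ (forall X Y Z : rib_cat c D,
        rib_mor (fwd (assoc (rib_monoidal S) X Y Z))
        = fwd (assoc M (rib_carrier X) (rib_carrier Y) (rib_carrier Z)))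
    /\ (forall X : rib_cat c D,
        rib_mor (fwd (lunit (rib_monoidal S) X))
        = fwd (lunit M (rib_carrier X)))
    /\ (forall X : rib_cat c D,
        rib_mor (fwd (runit (rib_monoidal S) X))
        = fwd (runit M (rib_carrier X)))
    /\ (forall X Y : rib_cat c D,
        rib_mor (fwd (rib_braiding S X Y))
        = fwd (c (rib_carrier X) (rib_carrier Y)))
    /\ (forall X : rib_cat c D,
        rib_mor (ev (rib_rigid S) X) = ev D (rib_carrier X))
    /\ (forall X : rib_cat c D,
        rib_mor (coev (rib_rigid S) X) = coev D (rib_carrier X))
    /\ (forall X : rib_cat c D,
        rib_mor (fwd (rib_twist S X)) = rib_eta X).
Proof.
exists (fun X Y => half_twist_tens (rib_etaP X) (rib_etaP Y)).
exists (half_twist_one c D).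
exists (fun X => half_twist_transpose (rib_etaP X)).
by exists (rib_ribbon c D).
Qed.
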